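(* Let $f:\mathbb{C}\to\mathbb{C}$ be a complex polynomial of degree $d\geq 2$ that is not conformally conjugate to $z^d$. Then $$\lim_{n\to\infty}\frac{S_{f^n}(z)}{d^{2n}}=-2\left(\frac{\partial G_f(z)}{\partial z}\right)^2$$ locally uniformly on $\mathbb{C}\setminus\overline{\mathrm{Precrit}(f)}$.
   Context: $f^n$ denotes $f$ composed with itself $n$ times. The Schwarzian derivative of a nonconstant holomorphic function $h$ is $S_h=\frac{h'''}{h'}-\frac32\left(\frac{h''}{h'}\right)^2$. The escape-rate function of $f$ is $G_f(z)=\lim_{n\to\infty}\frac{1}{d^n}\log^+|f^n(z)|$, with $\log^+|x|=\max(\log|x|,0)$. $\mathrm{Precrit}(f)=\bigcup_{n>0}\{c\in\mathbb{C}: (f^n)'(c)=0\}$, and the bar denotes closure in $\mathbb{C}$. $\partial/\partial z=\frac12(\partial_x-i\partial_y)$. (When $f$ is not conjugate to $z^d$, $\overline{\mathrm{Precrit}(f)}$ contains the Julia set of $f$.) *)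

(* Defs.v *)
From mathcomp Require Import all_boot all_order all_algebra.
From mathcomp Require Import all_classical all_reals all_analysis.
From mathcomp Require Import complex.

Set Implicit Arguments.
Unset Strict Implicit.
Unset Printing Implicit Defensive.

Import Order.TTheory GRing.Theory Num.Theory.
Import numFieldNormedType.Exports.

Local Open Scope classical_set_scope.
Local Open Scope ring_scope.
Local Open Scope complex_scope.

(* [R[i]^o] is [R[i]] with its usual topology, as a normed space over the field
   [R[i]]: [derivable] and [derive1] are then complex differentiability and the
   complex derivative. *)
Definition entire (R : realType) (h : R[i] -> R[i]) : Prop :=
  forall z : R[i], derivable (h : R[i]^o -> R[i]^o) z 1.

Definition cderive (R : realType) (h : R[i] -> R[i]) : R[i] -> R[i] :=
  derive1 (h : R[i] -> R[i]^o).

(* The conformal automorphisms of the plane are the biholomorphic maps. *)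
Definition conformally_conjugate (R : realType) (f g : R[i] -> R[i]) : Prop :=
  exists phi psi : R[i] -> R[i],
    [/\ cancel phi psi, cancel psi phi, entire phi, entire psi &
        forall z, phi (f z) = g (phi z)].

Definition Schwarzian (R : realType) (h : R[i] -> R[i]) (z : R[i]) : R[i] :=
  let h1 := cderive h in let h2 := cderive h1 in let h3 := cderive h2 in
  h3 z / h1 z - 3 / 2 * (h2 z / h1 z) ^+ 2.

(* As [ln 0 = 0] in the library, [logp 0 = 0], which agrees with the
   convention [log 0 = -oo]. *)
Definition logp (R : realType) (x : R) : R := Num.max (ln x) 0.

(* [Normc.normc] is the modulus with values in [R]; the generic norm
   [`|z|] has values in [R[i]]. *)
Definition escape_rate (R : realType) (d : nat) (f : R[i] -> R[i])
    (z : R[i]) : R :=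
  limn (fun n => logp (Normc.normc (iter n f z)) / d%:R ^+ n).

Definition Precrit (R : realType) (f : R[i] -> R[i]) : set R[i] :=
  \bigcup_(n in [set n | (0 < n)%N]) [set c | cderive (iter n f) c = 0].

Definition wirtinger_dz (R : realType) (G : R[i] -> R) (z : R[i]) : R[i] :=
  let dx : R := derive1 (fun x : R => G (x +i* complex.Im z)) (complex.Re z) in
  let dy : R := derive1 (fun y : R => G (complex.Re z +i* y)) (complex.Im z) in
  2^-1 * (dx -i* dy).

Definition locally_uniform_cvg (R : realType) (A : set R[i])
    (F : nat -> R[i] -> R[i]) (g : R[i] -> R[i]) : Prop :=
  forall z, A z ->
    exists2 V : set R[i], nbhs (z : R[i]^o) V &
      {uniform V `&` A, (F : nat -> R[i] -> R[i]^o) @ \oo -->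
                        (g : R[i] -> R[i]^o)}.

(* Main.v *)
Require Import Defs.
From mathcomp Require Import all_boot all_order all_algebra.
From mathcomp Require Import all_classical all_reals all_analysis.
From mathcomp Require Import complex ring lra zify.

Import Order.TTheory GRing.Theory Num.Theory.
Import numFieldNormedType.Exports.

Local Open Scope classical_set_scope.
Local Open Scope ring_scope.
Local Open Scope complex_scope.

(* Let [B_n = (f^n)'' / (f^n)'], the sum of [1 / (z - w)] over the critical
   points [w] of [f^n]. Then [S_{f^n} = B_n' - B_n^2 / 2], and [B_n'] is
   [O(d^n)] away from [Precrit f]; so everything reduces to
   [B_n / d^n -> 2 dG/dz]. Now [B_n / d^n] is the gradient of
   [U_n = d^-n ln |(f^n)'|], and the second derivatives of [U_n] are bounded
   uniformly in [n] away from [Precrit f]. By the Landau interpolation inequality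
   it is therefore enough that [U_n -> G] locally uniformly.

   By the chain rule this follows once [f^k z] is shown to approach a critical
   point [c] of [f] no faster than [exp (- C l^k)] for some [l < d]. As [f] is not
   conjugate to [z^d], no fibre of [g = f \o f] is a single point, and the diameters
   of the fibres are even bounded below. Hence
   [|g x - y| >= C dist (x, g^-1 y)^(d^2 - 1)], with exponent [d^2 - 1] instead
   of [d^2]. Pulling [c] back along the orbit of [z] bounds [|f^k z - c|] from below
   by a power, of order [(d^2 - 1)^(k / 2)], of the distance from [z] to
   [Precrit f]. *)

Set Implicit Arguments.
Unset Strict Implicit.
Unset Printing Implicit Defensive.

Local Notation nrm := (@Normc.normc _).

(** * The real-valued modulus on [R[i]] *)

Section Modulus.
Variable R : rcfType.
Implicit Types z w : R[i].

Lemma nrm_sqr z : nrm z ^+ 2 = complex.Re z ^+ 2 + complex.Im z ^+ 2.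
Proof. by case: z => a b /=; rewrite sqr_sqrtr // addr_ge0 ?sqr_ge0. Qed.

Lemma nrm_ge0 z : 0 <= nrm z.
Proof. by case: z => a b /=; exact: sqrtr_ge0. Qed.

Lemma nrm0 : nrm (0 : R[i]) = 0. Proof. exact: Normc.normc0. Qed.

Lemma nrm1 : nrm (1 : R[i]) = 1. Proof. exact: Normc.normc1. Qed.

Lemma nrm_eq0 z : (nrm z == 0) = (z == 0).
Proof. by apply/eqP/eqP => [/Normc.eq0_normc|->]; rewrite ?nrm0. Qed.

Lemma nrm_gt0 z : (0 < nrm z) = (z != 0).
Proof. by rewrite lt_def nrm_eq0 nrm_ge0 andbT. Qed.

Lemma nrmM z w : nrm (z * w) = nrm z * nrm w.
Proof. exact: Normc.normcM. Qed.

Lemma nrmV z : nrm z^-1 = (nrm z)^-1.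
Proof. exact: Normc.normcV. Qed.

Lemma nrmN z : nrm (- z) = nrm z.
Proof. exact: (@normcN R). Qed.

Lemma nrmD z w : nrm (z + w) <= nrm z + nrm w.
Proof. exact: (@le_normcD R). Qed.

Lemma nrmB z w : nrm (z - w) <= nrm z + nrm w.
Proof. by rewrite -(nrmN w) nrmD. Qed.

Lemma nrmBC z w : nrm (z - w) = nrm (w - z).
Proof. by rewrite -nrmN opprB. Qed.

Lemma nrmX z n : nrm (z ^+ n) = nrm z ^+ n.
Proof. by elim: n => [|n IH]; rewrite ?expr0 ?nrm1 // !exprS nrmM IH. Qed.

Lemma nrm_prod (T : Type) (s : seq T) (F : T -> R[i]) :
  nrm (\prod_(i <- s) F i) = \prod_(i <- s) nrm (F i).
Proof. by elim/big_ind2: _ => [|x a y b <- <-|//]; rewrite ?nrm1 ?nrmM. Qed.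

Lemma nrm_sum (T : Type) (s : seq T) (F : T -> R[i]) :
  nrm (\sum_(i <- s) F i) <= \sum_(i <- s) nrm (F i).
Proof.
elim/big_ind2: _ => [|x a y b h1 h2|//]; first by rewrite nrm0.
exact: le_trans (nrmD _ _) (lerD h1 h2).
Qed.

Lemma ler_Re_nrm z : `|complex.Re z| <= nrm z.
Proof.
rewrite -(ler_pXn2r (n := 2)) ?nnegrE ?normr_ge0 ?nrm_ge0 // nrm_sqr.
by rewrite real_normK ?num_real // lerDl sqr_ge0.
Qed.

Lemma Re_sum (T : Type) (s : seq T) (F : T -> R[i]) :
  complex.Re (\sum_(i <- s) F i) = \sum_(i <- s) complex.Re (F i).
Proof.
by elim/big_ind2: _ => // _ [x1 x2] _ [y1 y2] <- <-.
Qed.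

Lemma nrm_real (x : R) : nrm x%:C = `|x|.
Proof. by rewrite /= expr0n addr0 sqrtr_sqr. Qed.

Lemma nrm_imag (x : R) : nrm (x *i) = `|x|.
Proof. by rewrite /= expr0n add0r sqrtr_sqr. Qed.

Lemma nrm_le_ReIm z : nrm z <= `|complex.Re z| + `|complex.Im z|.
Proof.
case: z => a b; have -> : a +i* b = a%:C + b *i by simpc.
by apply: le_trans (nrmD _ _) _; rewrite nrm_real nrm_imag /= add0r addr0.
Qed.

Lemma nrm_nat (n : nat) : nrm (n%:R : R[i]) = n%:R.
Proof.
have -> : (n%:R : R[i]) = (n%:R : R)%:C by rewrite rmorph_nat.
by rewrite nrm_real ger0_norm.
Qed.

End Modulus.

(** * Logarithmic derivatives of products of linear factors *)

Section RootProducts.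
Variable K : fieldType.
Implicit Types (s : seq K) (z : K).

Let q s : {poly K} := \prod_(w <- s) ('X - w%:P).

Lemma horner_prod_XsubC s z : (q s).[z] = \prod_(w <- s) (z - w).
Proof. by rewrite horner_prod; apply: eq_bigr => w _; rewrite !hornerE. Qed.

Lemma deriv_prod_XsubC s z : z \notin s ->
  (q s)^`().[z] = (q s).[z] * \sum_(w <- s) (z - w)^-1.
Proof.
rewrite /q; elim: s => [|w s IH]; first by rewrite !big_nil derivC hornerC mulr0.
rewrite inE negb_or => /andP[zw zs]; rewrite !big_cons derivM derivXsubC mul1r.
rewrite hornerD !hornerM (IH zs) hornerXsubC.
have : z - w != 0 by rewrite subr_eq0.
by move=> zw0; field.
Qed.

Lemma deriv2_prod_XsubC s z : z \notin s ->
  (q s)^`()^`().[z] = (q s).[z] *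
    ((\sum_(w <- s) (z - w)^-1) ^+ 2 - \sum_(w <- s) (z - w)^-2).
Proof.
rewrite /q; elim: s => [|w s IH].
  by rewrite !big_nil derivC derivC hornerC expr0n subrr mulr0.
rewrite inE negb_or => /andP[zw zs]; rewrite !big_cons derivM derivXsubC mul1r.
rewrite derivD derivM derivXsubC mul1r !hornerD !hornerM.
rewrite hornerXsubC (IH zs) (deriv_prod_XsubC zs).
have : z - w != 0 by rewrite subr_eq0.
by move=> zw0; field.
Qed.

End RootProducts.

Section Roots.
Variable K : closedFieldType.

Lemma closed_poly_roots (p : {poly K}) : p != 0 -> exists s : seq K,
  [/\ size s = (size p).-1, p = lead_coef p *: \prod_(w <- s) ('X - w%:P)
    & forall w, (w \in s) = root p w].
Proof.
move=> p0; have [s Es] := closed_field_poly_normal p; exists s.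
have l0 : lead_coef p != 0 by rewrite lead_coef_eq0.
split=> // [|w]; first by rewrite Es size_scale // size_prod_XsubC.
by rewrite [in RHS]Es rootZ // root_prod_XsubC.
Qed.

End Roots.

(** * Critical points, fibres, and distance estimates under iteration *)

Section Ramification.
Variable R : rcfType.
Local Notation C := R[i].
Implicit Types (p g : {poly C}) (c x y w : C).

Lemma natC_neq0 (n : nat) : (n.+1%:R : C) != 0.
Proof. by rewrite pnatr_eq0. Qed.

Lemma size_derivC p : size p^`() = (size p).-1.
Proof.
have [->|p0] := eqVneq p 0; first by rewrite deriv0 size_poly0.
apply/eqP; rewrite eqn_leq; apply/andP; split.
  by have := lt_size_deriv p0; case: (size p).
have [/eqP ->|s1] := boolP ((size p).-1 == 0)%N; first by [].
case Ep: (size p) s1 => [|[|n]] // _ /=; rewrite ltnNge; apply/negP => h.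
have /eqP := nth_default 0 h; rewrite coef_deriv -mulr_natr.
have -> : p`_n.+1 = lead_coef p by rewrite lead_coefE Ep.
by rewrite mulf_eq0 lead_coef_eq0 (negbTE p0) /= (negbTE (natC_neq0 _)).
Qed.

Lemma deriv_eq0_const p : p^`() = 0 -> exists b, p = b%:P.
Proof.
move=> p'0; exists p`_0; apply: size1_polyC.
by have := size_derivC p; rewrite p'0 size_poly0; case: (size p) => [|[|]].
Qed.

Lemma deriv_single_root p c : (1 < size p)%N ->
  (forall x, root p^`() x -> x = c) ->
  exists a b, a != 0 /\ p = a *: ('X - c%:P) ^+ (size p).-1 + b%:P.
Proof.
move=> sp hc; set n := (size p).-1.
have n0 : (0 < n)%N by rewrite /n; case: (size p) sp => [|[|]].
have sp' : size p^`() = n by exact: size_derivC.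
have p'0 : p^`() != 0 by rewrite -size_poly_eq0 sp' -lt0n.
have [s [ss Ep rs]] := closed_poly_roots p'0.
have Eq : \prod_(w <- s) ('X - w%:P) = ('X - c%:P) ^+ n.-1.
  rewrite -sp' -ss big_seq.
  rewrite (eq_bigr (fun _ => 'X - c%:P)) => [|w ws]; last first.
    by rewrite (hc w) // -rs.
  by rewrite -big_seq big_const_seq count_predT iter_mulr_1.
set l := lead_coef p^`().
have l0 : l != 0 by rewrite lead_coef_eq0.
have nC : (n%:R : C) != 0 by rewrite pnatr_eq0 -lt0n.
have [b Eb] : exists b, p - (l / n%:R) *: ('X - c%:P) ^+ n = b%:P.
  apply: deriv_eq0_const; rewrite derivB derivZ deriv_exp derivXsubC mul1r Ep Eq.
  by rewrite -/l -scalerMnr scalerMnl -[_ *+ n]mulr_natr divfK // subrr.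
exists (l / n%:R), b; split; first by rewrite mulf_neq0 ?invr_eq0.
by rewrite -Eb addrC subrK.
Qed.

(* If [c] were the only critical point of [p \Po p], then [p^`()] would vanish
   only at [c], and only [c] could be mapped to [c]. *)
Lemma comp_self_two_critical_points p : (2 < size p)%N ->
  (forall a c, a != 0 -> p <> a *: ('X - c%:P) ^+ (size p).-1 + c%:P) ->
  exists c1 c2, [/\ c1 != c2, root (p \Po p)^`() c1 & root (p \Po p)^`() c2].
Proof.
move=> sp hp; have sp1 : (1 < size p)%N by exact: ltnW.
have [c rc] : exists c, root p^`() c.
  by apply/closed_rootP; rewrite size_derivC; case: (size p) sp => [|[|[|]]].
have rpp x : root p^`() p.[x] || root p^`() x -> root (p \Po p)^`() x.
  by rewrite deriv_comp rootM /root horner_comp.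
have rcc : root (p \Po p)^`() c by apply: rpp; rewrite rc orbT.
have [[c2 [h1 h2]]|no] :=
  pselect (exists c2, c2 != c /\ root (p \Po p)^`() c2).
  by exists c2, c.
have uniq x : root (p \Po p)^`() x -> x = c.
  by move=> rx; apply/eqP/negPn/negP => xc; apply: no; exists x.
have [a [b [a0 Ep]]] : exists a b, a != 0 /\
    p = a *: ('X - c%:P) ^+ (size p).-1 + b%:P.
  apply: deriv_single_root => // x rx; apply: uniq; apply: rpp.
  by rewrite rx orbT.
(* A preimage [x] of [c] is critical for [p \Po p], hence equals [c]. So [p] fixes [c], and [b = c]
   yields the excluded form. *)
have [x rx] : exists x, root (p - c%:P) x.
  apply/closed_rootP; rewrite size_polyDl ?size_polyN; last first.
    exact: leq_ltn_trans (size_polyC_leq1 _) _.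
  by case: (size p) sp => [|[|]].
have px : p.[x] = c by apply/eqP; move: rx; rewrite /root !hornerE subr_eq0.
have xc : x = c by apply/uniq/rpp; rewrite px rc.
case: (hp a c a0); rewrite [LHS]Ep; congr (_ + _%:P).
have := px; rewrite xc {1}Ep !hornerE subrr expr0n.
by case: (size p) sp => [|[|n]] //= _; rewrite mulr0 add0r.
Qed.

(** Up to the factor [2 |u - v|^2], the real part is [|u|^2 - |v|^2 + |u - v|^2]. *)
Lemma Re_div_sub_gt0 (u v : C) : nrm v < nrm u -> 0 < complex.Re (u / (u - v)).
Proof.
rewrite -(ltr_pXn2r (n := 2)) ?nnegrE ?nrm_ge0 // !nrm_sqr.
case: u v => [u1 u2] [v1 v2] /= h.
set A := u1 - v1; set B := u2 - v2.
have AB : 0 < A ^+ 2 + B ^+ 2.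
  rewrite lt_def addr_ge0 ?sqr_ge0 // andbT.
  apply/negP; rewrite paddr_eq0 ?sqr_ge0 // !sqrf_eq0 /A /B !subr_eq0.
  by case/andP=> /eqP a1 /eqP a2; move: h; rewrite a1 a2 ltxx.
have -> : u1 * (A / (A ^+ 2 + B ^+ 2)) - u2 * - (B / (A ^+ 2 + B ^+ 2)) =
   (u1 * A + u2 * B) / (A ^+ 2 + B ^+ 2) by ring.
rewrite divr_gt0 // -(pmulr_rgt0 _ (ltr0n R 2)).
have -> : 2 * (u1 * A + u2 * B) =
    (u1 ^+ 2 + u2 ^+ 2 - (v1 ^+ 2 + v2 ^+ 2)) + (A ^+ 2 + B ^+ 2).
  by rewrite /A /B; ring.
by rewrite addr_gt0 // subr_gt0.
Qed.

(* A critical point [c] of [g] satisfies [\sum_w (c - w)^-1 = 0], the sum over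
   the roots of [g - y]; this is impossible when the roots cluster around [x]
   and [c] is far from [x]. *)
Lemma critical_point_near_fibre g c x y (e : R) : (1 < size g)%N ->
  root g^`() c -> (forall w, g.[w] = y -> nrm (x - w) < e) ->
  nrm (c - x) < e.
Proof.
move=> sg rc near; rewrite ltNge; apply/negP => far.
have sgy : size (g - y%:P) = size g.
  by rewrite size_polyDl ?size_polyN // (leq_ltn_trans (size_polyC_leq1 _)).
have gy0 : g - y%:P != 0 by rewrite -size_poly_gt0 sgy ltnW.
have [s [ss Es rs]] := closed_poly_roots gy0.
have near' w : w \in s -> nrm (w - x) < nrm (c - x).
  rewrite rs /root !hornerE subr_eq0 => /eqP /near; rewrite nrmBC => h.
  exact: lt_le_trans far.
have cs : c \notin s by apply/negP => /near'; rewrite ltxx.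
have : (g - y%:P)^`().[c] = 0.
  by rewrite derivB derivC subr0; apply/eqP.
rewrite Es derivZ hornerZ deriv_prod_XsubC // mulrA => /eqP.
have ne0 : lead_coef (g - y%:P) * (\prod_(w <- s) ('X - w%:P)).[c] != 0.
  rewrite mulf_neq0 ?lead_coef_eq0 //.
  by have := root_prod_XsubC s c; rewrite (negbTE cs) /root => ->.
rewrite mulf_eq0 (negbTE ne0) /= => /eqP sum0.
(* Multiplying the vanishing sum by [c - x] gives every term a positive real part, since each root
   [w] is closer to [x] than [c] is. *)
have : \sum_(w <- s) complex.Re ((c - x) / (c - w)) = 0.
  rewrite -Re_sum.
  by rewrite -mulr_sumr sum0 mulr0.
have sgt0 : (0 < size s)%N by rewrite ss sgy; case: (size g) sg => [|[|]].
have pos w : w \in s -> 0 < complex.Re ((c - x) / (c - w)).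
  move=> ws; have -> : c - w = (c - x) - (w - x) by ring.
  exact/Re_div_sub_gt0/near'.
case: s sgt0 pos {ss Es rs near' cs ne0 sum0} => // w s _ pos.
rewrite big_cons => E; have := pos w (mem_head _ _).
rewrite -[ltRHS]opprK (addr0_eq E) oppr_gt0 ltNge big_seq sumr_ge0 // => v vs.
by apply/ltW/pos; rewrite inE vs orbT.
Qed.

(** A fibre within [e] of [x] would force both critical points within [e] of [x]; with [e] half
    their distance, this contradicts the triangle inequality. *)
Lemma fibre_not_clustered g : (1 < size g)%N ->
  (exists c1 c2, [/\ c1 != c2, root g^`() c1 & root g^`() c2]) ->
  exists2 e : R, 0 < e & forall x y, exists w, g.[w] = y /\ e <= nrm (x - w).
Proof.
move=> sg [c1 [c2 [c12 r1 r2]]]; exists (nrm (c1 - c2) / 2).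
  by rewrite divr_gt0 // nrm_gt0 subr_eq0.
move=> x y; apply/not_existsP => no.
have near w : g.[w] = y -> nrm (x - w) < nrm (c1 - c2) / 2.
  by move=> gw; rewrite ltNge; apply/negP => h; apply: (no w).
have h1 := critical_point_near_fibre sg r1 near.
have h2 := critical_point_near_fibre sg r2 near.
have := nrmB (c1 - x) (c2 - x).
rewrite (_ : c1 - x - (c2 - x) = c1 - c2); last by ring.
lra.
Qed.

Lemma nearest_in_seq (s : seq C) x : (0 < size s)%N ->
  exists2 w, w \in s & forall v, v \in s -> nrm (x - w) <= nrm (x - v).
Proof.
elim: s => // u [|u' s] IH _.
  by exists u; rewrite ?mem_head // => v; rewrite inE => /eqP ->.
have [//|w ws hw] := IH; have [h|h] := leP (nrm (x - u)) (nrm (x - w)).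
  exists u; rewrite ?mem_head // => v; rewrite inE => /orP[/eqP -> //|/hw].
  exact: le_trans.
exists w; first by rewrite inE ws orbT.
by move=> v; rewrite inE => /orP[/eqP -> |/hw //]; exact: ltW.
Qed.

Lemma expr_nearest_le_prod (s : seq C) x (r : R) : 0 <= r ->
  (forall v, v \in s -> r <= nrm (x - v)) ->
  r ^+ size s <= \prod_(v <- s) nrm (x - v).
Proof.
move=> r0; elim: s => [|u s IH] h; first by rewrite big_nil.
rewrite big_cons exprS ler_pM ?exprn_ge0 ?h ?mem_head //.
by apply: IH => v vs; rewrite h // inE vs orbT.
Qed.

Lemma fibre_roots g x y : (1 < size g)%N -> exists s : seq C,
  [/\ size s = (size g).-1, (forall w, (w \in s) = (g.[w] == y))
    & nrm (g.[x] - y) = nrm (lead_coef g) * \prod_(w <- s) nrm (x - w)].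
Proof.
move=> sg; have szlt : (size (- y%:P) < size g)%N.
  by rewrite size_polyN (leq_ltn_trans (size_polyC_leq1 _)).
have sgy : size (g - y%:P) = size g by rewrite size_polyDl.
have gy0 : g - y%:P != 0 by rewrite -size_poly_gt0 sgy ltnW.
have [s [ss Es rs]] := closed_poly_roots gy0; exists s; split.
- by rewrite ss sgy.
- by move=> w; rewrite rs /root !hornerE subr_eq0.
have -> : g.[x] - y = (g - y%:P).[x] by rewrite !hornerE.
by rewrite Es hornerZ horner_prod_XsubC nrmM nrm_prod lead_coefDl.
Qed.

(** In the factorization of [g - y], each factor at [x] is at least the distance to the nearest
    point [w] of the fibre. *)
Lemma fibre_dist_lower g x y : (1 < size g)%N -> exists w,
  g.[w] = y /\ nrm (lead_coef g) * nrm (x - w) ^+ (size g).-1 <= nrm (g.[x] - y).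
Proof.
move=> sg; have [s [ss rs ->]] := fibre_roots x y sg.
have [|w ws hw] := nearest_in_seq (s := s) x.
  by rewrite ss; case: (size g) sg => [|[|]].
exists w; split; first by apply/eqP; rewrite -rs.
by rewrite ler_wpM2l ?nrm_ge0 // -ss expr_nearest_le_prod ?nrm_ge0.
Qed.

(** Some point of the fibre lies at distance at least [e] from [x]; bounding its factor by [e] and
    the others by the nearest distance lowers the exponent by one. *)
Lemma fibre_dist_lower_unramified g : (1 < size g)%N ->
  (exists c1 c2, [/\ c1 != c2, root g^`() c1 & root g^`() c2]) ->
  exists2 e : R, 0 < e & forall x y, exists w,
    g.[w] = y /\ e * nrm (x - w) ^+ (size g).-2 <= nrm (g.[x] - y).
Proof.
move=> sg hc; have [e e0 he] := fibre_not_clustered sg hc.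
have l0 : 0 < nrm (lead_coef g).
  by rewrite nrm_gt0 lead_coef_eq0 -size_poly_gt0 ltnW.
exists (nrm (lead_coef g) * e); first by rewrite mulr_gt0.
move=> x y; have [s [ss rs ->]] := fibre_roots x y sg.
have [|w ws hw] := nearest_in_seq (s := s) x.
  by rewrite ss; case: (size g) sg => [|[|]].
exists w; split; first by apply/eqP; rewrite -rs.
have [v [gv ev]] := he x y.
have vs : v \in s by rewrite rs gv.
rewrite (perm_big _ (perm_to_rem vs)) /= big_cons -mulrA ler_pM2l //.
apply: (ler_pM (ltW e0) _ ev); first by rewrite exprn_ge0 ?nrm_ge0.
rewrite (_ : (size g).-2 = size (rem v s)); last by rewrite size_rem // ss.
apply: expr_nearest_le_prod; rewrite ?nrm_ge0 // => u /mem_rem; exact: hw.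
Qed.

(** The point [y] is pulled back one step at a time, each time to the preimage provided by the
    one-step estimate. The normalization [T * (r / T) ^+ N] keeps the constant stable: [1 <= e * T]
    and an exponent [E] at least 2 give [T <= e * T ^+ E]. *)
Lemma iter_fibre_dist_lower g : (3 < size g)%N ->
  (exists c1 c2, [/\ c1 != c2, root g^`() c1 & root g^`() c2]) ->
  exists2 T : R, 1 <= T & forall k x y, exists w, iter k (horner g) w = y /\
    T * (nrm (x - w) / T) ^+ ((size g).-2 ^ k) <= nrm (iter k (horner g) x - y).
Proof.
move=> sg3 hc; have sg : (1 < size g)%N by apply: ltn_trans sg3.
have [e e0 he] := fibre_dist_lower_unramified sg hc.
set E := (size g).-2 in he *.
have E2 : (1 < E)%N by rewrite /E; case: (size g) sg3 => [|[|[|[|]]]].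
set T := Num.max 1 e^-1; exists T; first by rewrite le_max lexx.
have T1 : 1 <= T by rewrite le_max lexx.
have T0 : 0 < T by apply: lt_le_trans T1.
have eT : 1 <= e * T.
  by rewrite mulrC -ler_pdivrMr // mul1r /T le_max lexx orbT.
elim=> [|k IH] x y.
  by exists y; rewrite expn0 expr1 mulrC divfK ?gt_eqF.
have [w1 [gw1 h1]] := he (iter k (horner g) x) y.
have [w [gw h]] := IH x w1; exists w; split; first by rewrite iterS gw.
apply: le_trans h1; set r := nrm (x - w) / T in h *.
have r0 : 0 <= r by rewrite divr_ge0 ?nrm_ge0 // ltW.
rewrite expnSr exprM; set u := r ^+ _ in h *.
have u0 : 0 <= u by rewrite exprn_ge0.
apply: (@le_trans _ _ (e * (T * u) ^+ E)); last first.
  rewrite ler_pM2l //; apply: lerXn2r => //; rewrite nnegrE ?nrm_ge0 //.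
  by rewrite mulr_ge0 // ltW.
rewrite exprMn mulrA ler_wpM2r ?exprn_ge0 //.
rewrite -(prednK (n := E)) ?(ltnW E2) // exprS mulrCA ler_peMr ?(ltW T0) //.
apply: le_trans eT _; rewrite ler_pM2l // ler_eXnr //.
by rewrite -ltnS prednK // ltnW.
Qed.

Lemma iter2_comp_self p k x :
  iter k (horner (p \Po p)) x = iter k.*2 (horner p) x.
Proof. by elim: k => //= k ->; rewrite horner_comp. Qed.

(* The exponent [d ^ 2 - 1] per two iterations, instead of [d ^ 2], is what
   makes [d ^- k * ln (nrm (iter k f x - y))] asymptotically nonnegative. *)
Lemma iter_dist_lower p (E := ((size p).-1 ^ 2).-1) : (2 < size p)%N ->
  (forall a c, a != 0 -> p <> a *: ('X - c%:P) ^+ (size p).-1 + c%:P) ->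
  forall e : R, 0 < e -> exists2 b : R, 0 < b <= 1 & forall k x y,
    (forall w, iter k (horner p) w = y -> e <= nrm (x - w)) ->
    b ^+ (E ^ k./2) <= nrm (iter k (horner p) x - y).
Proof.
move=> sp hp e e0; set g := p \Po p.
have sg : (size g).-1 = ((size p).-1 ^ 2)%N by rewrite size_comp_poly mulnn.
have d2 : (1 < (size p).-1)%N by case: (size p) sp => [|[|[|]]].
have d4 : (4 <= (size p).-1 ^ 2)%N by rewrite (leq_exp2r 2 _ (e := 2)).
have sg3 : (3 < size g)%N by move: d4; rewrite -sg; lia.
have [T T1 hT] := iter_fibre_dist_lower sg3 (comp_self_two_critical_points sp hp).
have EE : (size g).-2 = E by rewrite sg.
rewrite EE in hT.
set l := nrm (lead_coef p).
have l0 : 0 < l by rewrite nrm_gt0 lead_coef_eq0 -size_poly_gt0 (ltn_trans _ sp).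
have T0 : 0 < T by apply: lt_le_trans T1.
(* The two quotients are the values of [r / T] for even and for odd [k]. *)
pose b := Num.min 1 (Num.min (e / T) (l * e ^+ (size p).-1 / T)).
have b0 : 0 < b by rewrite !lt_min ltr01 !divr_gt0 // mulr_gt0 // exprn_gt0.
exists b => [|k x y hw]; first by rewrite b0 ge_min lexx.
suff [r [br hr]] : exists r, b <= r / T /\
    (T * (r / T) ^+ (E ^ k./2) <= nrm (iter k (horner p) x - y)).
  apply: le_trans hr; rewrite -[leLHS]mul1r.
  apply: ler_pM; rewrite ?exprn_ge0 ?(ltW b0) //; apply: lerXn2r => //.
    by rewrite nnegrE ltW.
  by rewrite nnegrE (le_trans (ltW b0)).
(* For odd [k] the iterate is a power of [g] applied to [p.[x]]; the remaining first application of
   [p] is handled by [fibre_dist_lower], with its full exponent, only once. *)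
have [odk|evk] := boolP (odd k).
  have Ek : k = (k./2.*2).+1 by rewrite -[LHS]odd_double_half odk.
  set j := k./2 in Ek *.
  have [w1 [gw1 h1]] := hT j p.[x] y.
  have [w [gw hw']] := fibre_dist_lower x w1 (ltnW sp).
  exists (l * e ^+ (size p).-1); split; first by rewrite !ge_min lexx !orbT.
  rewrite Ek iterSr -iter2_comp_self; apply: le_trans h1.
  rewrite ler_pM2l //; apply: lerXn2r; rewrite ?nnegrE.
  - by rewrite divr_ge0 ?mulr_ge0 ?exprn_ge0 // ltW.
  - by rewrite divr_ge0 ?nrm_ge0 // ltW.
  rewrite ler_pdivlMr // divfK ?gt_eqF //; apply: le_trans hw'.
  rewrite ler_pM2l //; apply: lerXn2r; rewrite ?nnegrE ?nrm_ge0 ?(ltW e0) //.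
  by apply: hw; rewrite Ek iterSr gw -iter2_comp_self.
have Ek : k = k./2.*2 by rewrite -[LHS]odd_double_half (negbTE evk).
have [w [gw h]] := hT k./2 x y.
exists e; split; first by rewrite !ge_min lexx !orbT.
rewrite [in iter k _ _]Ek -iter2_comp_self; apply: le_trans h.
rewrite ler_pM2l //; apply: lerXn2r; rewrite ?nnegrE.
- by rewrite divr_ge0 // ltW.
- by rewrite divr_ge0 ?nrm_ge0 // ltW.
rewrite ler_pM2r ?invr_gt0 //; apply: hw.
by rewrite Ek -iter2_comp_self.
Qed.

End Ramification.

(** * Logarithmic size of polynomial values, and geometric convergence *)

Section LogModulus.
Variable R : realType.
Local Notation C := R[i].
Implicit Types (z w c : C) (q : {poly C}).

Lemma logp_ge0 (x : R) : 0 <= logp x.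
Proof. by rewrite /logp le_max lexx orbT. Qed.

Lemma ln_le_logp (x : R) : ln x <= logp x.
Proof. by rewrite /logp le_max lexx. Qed.

Lemma logp_le (x y : R) : x <= y -> 1 <= y -> logp x <= ln y.
Proof.
move=> xy y1; rewrite /logp ge_max ln_ge0 // andbT.
(* For nonpositive [x] the default [ln x = 0] is below [ln y] because [1 <= y]. *)
have [x0|x0] := leP x 0; first by rewrite ln0 // ln_ge0.
by rewrite ler_ln ?posrE // (lt_le_trans ltr01).
Qed.

Lemma logp_id (x : R) : 1 <= x -> logp x = ln x.
Proof. by move=> x1; rewrite /logp; apply/max_idPl/ln_ge0. Qed.

Lemma ln_nrm_sub_le w c : w != c ->
  ln (nrm (w - c)) <= logp (nrm w) + ln (1 + nrm c).
Proof.
move=> wc; have c0 := nrm_ge0 c; have w0 := nrm_ge0 w.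
have p0 : 0 < nrm (w - c) by rewrite nrm_gt0 subr_eq0.
have [w1|w1] := leP 1 (nrm w).
  rewrite logp_id // -lnM ?posrE ?(lt_le_trans ltr01) // ?lerDl //.
  rewrite ler_ln ?posrE // ?mulr_gt0 // ?(lt_le_trans ltr01) // ?lerDl //.
  by apply: le_trans (nrmB _ _) _; nra.
apply: le_trans (_ : ln (1 + nrm c) <= _); last by rewrite lerDr logp_ge0.
rewrite ler_ln ?posrE ?ltr_pwDl //.
by apply: le_trans (nrmB _ _) _; lra.
Qed.

(** For [w] far from [c], [|w - c|] is comparable to [|w|]. Otherwise [logp (nrm w)] is bounded by
    the constant, and the assumed bound [- B] suffices. *)
Lemma ln_nrm_sub_ge w c (B : R) : 0 <= B -> - B <= ln (nrm (w - c)) ->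
  logp (nrm w) - B - ln (2 + 2 * nrm c) <= ln (nrm (w - c)).
Proof.
move=> B0 hB; have c0 := nrm_ge0 c; have w0 := nrm_ge0 w.
have tri : nrm w - nrm c <= nrm (w - c).
  by rewrite lerBlDr -{1}(subrK c w) nrmD.
have [far|near] := leP (1 + 2 * nrm c) (nrm w); last first.
  have := @logp_le (nrm w) (2 + 2 * nrm c).
  have : nrm w <= 2 + 2 * nrm c by lra.
  by move=> h /(_ h); have h2 : 1 <= 2 + 2 * nrm c by [lra]; move=> /(_ h2); lra.
rewrite logp_id; last by lra.
have h : ln (nrm w) - ln (2 + 2 * nrm c) <= ln (nrm (w - c)).
  rewrite -ln_div ?posrE; [|lra|lra].
  rewrite ler_ln ?posrE; [|by rewrite divr_gt0; lra|lra].
  by rewrite ler_pdivrMr; [nra|lra].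
lra.
Qed.

Lemma ln_nrm_horner q : q != 0 -> exists s : seq C,
  [/\ size s = (size q).-1, q = lead_coef q *: \prod_(w <- s) ('X - w%:P),
      forall w, (w \in s) = root q w
    & forall w, ~~ root q w -> ln (nrm q.[w]) =
        ln (nrm (lead_coef q)) + \sum_(c <- s) ln (nrm (w - c))].
Proof.
move=> q0; have [s [ss Es rs]] := closed_poly_roots q0; exists s; split=> // w.
rewrite -rs => ws; rewrite [in LHS]Es hornerZ horner_prod_XsubC nrmM nrm_prod.
have l0 : 0 < nrm (lead_coef q) by rewrite nrm_gt0 lead_coef_eq0.
suff [pgt ->] : 0 < \prod_(c <- s) nrm (w - c) /\
    \sum_(c <- s) ln (nrm (w - c)) = ln (\prod_(c <- s) nrm (w - c)).
  by rewrite lnM ?posrE.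
elim: s ws {ss Es rs} => [|c s IH]; first by rewrite !big_nil ln1.
rewrite inE negb_or => /andP[wc /IH[h E]]; rewrite !big_cons E.
have wc0 : 0 < nrm (w - c) by rewrite nrm_gt0 subr_eq0.
by split; rewrite ?mulr_gt0 // lnM ?posrE.
Qed.

Lemma natr_mul_sum_const (T : Type) (s : seq T) (x : R) :
  (size s)%:R * x = \sum_(i <- s) x.
Proof. by rewrite big_const_seq count_predT iter_addr_0 mulr_natl. Qed.

Lemma ln_nrm_horner_le q : q != 0 -> exists2 K : R, 0 <= K &
  forall w, ~~ root q w -> ln (nrm q.[w]) <= (size q).-1%:R * logp (nrm w) + K.
Proof.
move=> q0; have [s [<- _ rs Eq]] := ln_nrm_horner q0.
exists (`|ln (nrm (lead_coef q))| + \sum_(c <- s) ln (1 + nrm c)).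
  rewrite addr_ge0 ?normr_ge0 // sumr_ge0 // => c _.
  by rewrite ln_ge0 // lerDl nrm_ge0.
move=> w qw; rewrite Eq // addrCA lerD ?ler_norm //.
rewrite natr_mul_sum_const -big_split /= big_seq [leRHS]big_seq ler_sum // => c cs.
by rewrite ln_nrm_sub_le //; apply: contraNneq qw => ->; rewrite -rs.
Qed.

(** [K] is independent of [B]: closeness to the roots is paid for only by the term in [B], which may
    grow along an orbit. *)
Lemma ln_nrm_horner_ge q : q != 0 -> exists2 K : R, 0 <= K &
  forall w (B : R), 0 <= B -> ~~ root q w ->
    (forall c, root q c -> - B <= ln (nrm (w - c))) ->
    (size q).-1%:R * (logp (nrm w) - B) - K <= ln (nrm q.[w]).
Proof.
move=> q0; have [s [<- _ rs Eq]] := ln_nrm_horner q0.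
exists (`|ln (nrm (lead_coef q))| + \sum_(c <- s) ln (2 + 2 * nrm c)).
  rewrite addr_ge0 ?normr_ge0 // sumr_ge0 // => c _.
  by rewrite ln_ge0 //; have := nrm_ge0 c; lra.
move=> w B B0 qw hB; rewrite Eq //.
have : (size s)%:R * (logp (nrm w) - B) - \sum_(c <- s) ln (2 + 2 * nrm c) <=
    \sum_(c <- s) ln (nrm (w - c)).
  rewrite natr_mul_sum_const -sumrB big_seq [leRHS]big_seq ler_sum // => c cs.
  by rewrite ln_nrm_sub_ge // hB // -rs.
by have := lerNnormlW (lexx `|ln (nrm (lead_coef q))|); lra.
Qed.

(** For the lower bound, either [w] is within 1 of a root, so that [logp (nrm w)] is bounded
    (constant [K3]), or [ln_nrm_horner_ge] applies with [B = 0]. *)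
Lemma logp_horner q : (1 < size q)%N -> exists2 K : R, 0 <= K &
  forall w, `|logp (nrm q.[w]) - (size q).-1%:R * logp (nrm w)| <= K.
Proof.
move=> sq; have q0 : q != 0 by rewrite -size_poly_gt0 ltnW.
have [K1 K10 h1] := ln_nrm_horner_le q0.
have [K2 K20 h2] := ln_nrm_horner_ge q0.
have [s [ss _ rs _]] := ln_nrm_horner q0.
set d : R := (size q).-1%:R in h1 h2 *; have d0 : 0 <= d by [].
set K3 := d * \sum_(c <- s) ln (1 + nrm c).
have lc0 c : 0 <= ln (1 + nrm c) by rewrite ln_ge0 // lerDl nrm_ge0.
have K30 : 0 <= K3 by rewrite mulr_ge0 // sumr_ge0.
exists (K1 + K2 + K3); first by rewrite !addr_ge0.
move=> w; rewrite ler_norml; apply/andP; split.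
  have [near|far] := pselect (exists2 c, root q c & nrm (w - c) < 1).
    have [c rc cw] := near.
    have : logp (nrm w) <= ln (1 + nrm c).
      apply: logp_le; last by rewrite lerDl nrm_ge0.
      by rewrite -{1}(subrK c w) (le_trans (nrmD _ _)) // lerD2r ltW.
    have : ln (1 + nrm c) <= \sum_(c <- s) ln (1 + nrm c).
      by rewrite (big_rem c) ?rs //= lerDl sumr_ge0.
    have := logp_ge0 (nrm q.[w]).
    move=> a1 a2 a3; have : d * logp (nrm w) <= K3.
      by rewrite ler_wpM2l // (le_trans a3).
    lra.
  have qw : ~~ root q w.
    apply/negP => rw; apply: far; exists w; by rewrite // subrr nrm0.
  have := h2 w 0 (lexx _) qw; rewrite subr0 oppr0 => h.
  have : d * logp (nrm w) - K2 <= ln (nrm q.[w]).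
    apply: h => c rc; rewrite ln_ge0 // leNgt; apply/negP => cw.
    by apply: far; exists c.
  have := ln_le_logp (nrm q.[w]); lra.
have := logp_ge0 (nrm w) => Lw.
have dL : 0 <= d * logp (nrm w) by rewrite mulr_ge0.
have [q1|q1] := leP (nrm q.[w]) 1.
  have : logp (nrm q.[w]) <= ln 1 by apply: logp_le.
  by rewrite ln1; lra.
have qw : ~~ root q w by rewrite /root -nrm_eq0 gt_eqF // (lt_trans ltr01).
have h := h1 w qw; rewrite (logp_id (ltW q1)); lra.
Qed.

(** With [t n = K / d^n], [d >= 2] gives [t n.+1 <= t n - t n.+1], so [u - t] increases and [u + t]
    decreases. They enclose the common limit, with no loss in the constant. *)
Lemma cvg_geometric_increments (u : R^nat) (d : nat) (K : R) : (2 <= d)%N ->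
  0 <= K -> (forall n, `|u n.+1 - u n| <= K / d%:R ^+ n.+1) ->
  forall n, `|u n - limn u| <= K / d%:R ^+ n.
Proof.
move=> d2 K0 hu.
have d2R : 2 <= d%:R :> R by rewrite ler_nat.
have d0R : 0 < d%:R :> R by apply: lt_le_trans d2R.
pose t n : R := K / d%:R ^+ n.
have tS n : 2 * t n.+1 <= t n.
  have -> : t n = d%:R * t n.+1.
    by rewrite /t exprS invfM mulrCA mulVKf // gt_eqF.
  by rewrite ler_wpM2r // /t divr_ge0 // exprn_ge0 // ltW.
have t0 n : 0 <= t n by rewrite divr_ge0 // exprn_ge0 // ltW.
have tcvg : t @ \oo --> 0.
  rewrite -(mulr0 K); apply: cvgMr.
  rewrite (_ : (fun n => _) = (fun n => d%:R^-1 ^+ n)); last first.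
    by apply/funext => n; rewrite exprVn.
  apply: cvg_expr; rewrite ger0_norm ?invr_ge0 ?(ltW d0R) //.
  by rewrite invf_lt1 // (lt_le_trans _ d2R) // ltr1n.
have inc n : `|u n.+1 - u n| <= t n.+1 := hu n.
have a_nd : nondecreasing_seq (fun n => u n - t n).
  apply/nondecreasing_seqP => n; move: (inc n) (tS n); rewrite ler_norml; lra.
have b_ni : nonincreasing_seq (fun n => u n + t n).
  apply/nonincreasing_seqP => n; move: (inc n) (tS n); rewrite ler_norml; lra.
have a_cvg : cvgn (fun n => u n - t n).
  apply: nondecreasing_is_cvgn => //; exists (u 0%N + t 0%N) => _ [n _ <-].
  have := b_ni 0%N n (leq0n n); have := t0 n; rewrite /=; lra.
have u_cvg : cvgn u.
  rewrite (_ : u = (fun n => u n - t n) \+ t); last first.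
    by apply/funext => n /=; rewrite subrK.
  by apply: is_cvgD => //; apply/cvg_ex; exists 0.
have limt : limn t = 0 by apply/cvg_lim.
have tc : cvgn t by apply/cvg_ex; exists 0.
have lima : limn (fun n => u n - t n) = limn u.
  by rewrite limB // limt subr0.
have limb : limn (fun n => u n + t n) = limn u.
  by rewrite limD // limt addr0.
move=> n; rewrite ler_norml; apply/andP; split.
  have b_cvg : cvgn (fun n => u n + t n) by exact: is_cvgD u_cvg tc.
  have := nonincreasing_cvgn_ge b_ni b_cvg n; rewrite limb.
  by rewrite -/(t n); lra.
have := nondecreasing_cvgn_le a_nd a_cvg n; rewrite lima -/(t n); lra.
Qed.

End LogModulus.

(** * Growth of [ln |(f^n)'|] away from the precritical points *)

Section Iteration.
Variables (R : realType) (p : {poly R[i]}).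
Local Notation C := R[i].
Local Notation d := (size p).-1.
Local Notation f := (horner p).
Hypothesis sp : (2 < size p)%N.
Hypothesis hp : forall a c : C, a != 0 -> p <> a *: ('X - c%:P) ^+ d + c%:P.

Definition iter_poly n : {poly C} := iter n (fun q => p \Po q) 'X.

Lemma horner_iter_poly n z : (iter_poly n).[z] = iter n f z.
Proof. by elim: n => [|n IH]; rewrite /iter_poly /= ?hornerX // horner_comp IH. Qed.

Lemma size_iter_poly n : (size (iter_poly n)).-1 = (d ^ n)%N.
Proof.
elim: n => [|n IH]; first by rewrite size_polyX.
by rewrite /iter_poly iterS size_comp_poly IH expnS.
Qed.

Lemma deriv_iter_polyS n z : (iter_poly n.+1)^`().[z] =
  p^`().[iter n f z] * (iter_poly n)^`().[z].
Proof. by rewrite /iter_poly iterS deriv_comp hornerM horner_comp horner_iter_poly. Qed.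

Lemma degree_ge2 : (2 <= d)%N. Proof. by case: (size p) sp. Qed.

Let dR0 : 0 < d%:R :> R. Proof. by rewrite ltr0n (ltn_trans _ degree_ge2). Qed.

(** By [logp_horner] the sequence defining the escape rate has increments at most [K / d^n.+1]; its
    distance to the limit is then multiplied by [d^n]. *)
Lemma escape_rate_iter : exists2 K : R, 0 <= K & forall z n,
  `|logp (nrm (iter n f z)) - d%:R ^+ n * escape_rate d f z| <= K.
Proof.
have [K K0 hK] := logp_horner (ltnW sp); exists K => // z n.
pose u n := logp (nrm (iter n f z)) / d%:R ^+ n.
have dn0 m : 0 < d%:R ^+ m :> R by rewrite exprn_gt0.
have inc m : `|u m.+1 - u m| <= K / d%:R ^+ m.+1.
  rewrite /u iterS.
  have -> : logp (nrm (iter m f z)) / d%:R ^+ m =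
      d%:R * logp (nrm (iter m f z)) / d%:R ^+ m.+1.
    by rewrite exprS invfM mulrACA divff ?mul1r // gt_eqF.
  rewrite -mulrBl normrM [X in _ * X]ger0_norm ?invr_ge0 ?(ltW (dn0 _)) //.
  by rewrite ler_pM2r ?invr_gt0.
have := cvg_geometric_increments degree_ge2 K0 inc n.
rewrite ler_pdivlMr // -[X in _ * X]ger0_norm ?(ltW (dn0 n)) // -normrM mulrBl.
by rewrite /u divfK ?gt_eqF // [X in _ - X]mulrC.
Qed.

(* The exponent in [iter_dist_lower] is multiplied by [d ^ 2 - 1] every two
   iterations. *)
Definition growth : R := Num.sqrt (d ^ 2).-1%:R.

Lemma growth_gt1 : 1 < growth.
Proof.
rewrite -[ltLHS]sqrtr1 ltr_sqrt ?ltr0n ?ltr1n.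
all: have : (2 ^ 2 <= d ^ 2)%N by rewrite leq_exp2r // degree_ge2.
all: lia.
Qed.

Lemma growth_ltd : growth < d%:R.
Proof.
rewrite -[ltRHS]ger0_norm // -sqrtr_sqr ltr_sqrt ?exprn_gt0 //.
rewrite -natrX ltr_nat prednK // expn_gt0 (leq_trans _ degree_ge2) //.
Qed.

Lemma growth_half k : ((d ^ 2).-1 ^ k./2)%N%:R <= growth ^+ k.
Proof.
rewrite -{2}(odd_double_half k) exprD -muln2 mulnC exprM.
rewrite {2}/growth sqr_sqrtr // natrX ler_peMl ?exprn_ge0 //.
by rewrite exprn_ege1 // ltW // growth_gt1.
Qed.

(** [ln |p'(w)|] is [(d - 1) logp |w|] up to a constant and the closeness of [w] to critical points.
    For [w = f^k z], [escape_rate_iter] controls [logp |w|] and [iter_dist_lower] limits the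
    closeness. *)
Lemma ln_deriv_along_orbit (e : R) : 0 < e -> exists2 E : R, 0 <= E &
  forall z : C, (forall n w, root (iter_poly n)^`() w -> e <= nrm (z - w)) ->
  forall k, `|ln (nrm p^`().[iter k f z]) -
    (d.-1)%:R * d%:R ^+ k * escape_rate d f z| <= E * growth ^+ k.
Proof.
move=> e0; have [b /andP[b0 b1] hb] := iter_dist_lower sp hp e0.
have [K K0 hK] := escape_rate_iter.
have p'0 : p^`() != 0.
  by rewrite -size_poly_eq0 size_derivC -lt0n (ltn_trans _ degree_ge2).
have [K1 K10 h1] := ln_nrm_horner_le p'0.
have [K2 K20 h2] := ln_nrm_horner_ge p'0.
rewrite size_derivC in h1 h2.
have B0 : 0 <= - ln b by rewrite oppr_ge0 ln_le0.
have d10 : 0 <= d.-1%:R :> R by [].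
exists (d.-1%:R * (K + - ln b) + K1 + K2); first by rewrite !addr_ge0 ?mulr_ge0 ?addr_ge0.
move=> z hz k; set w := iter k f z; set G := escape_rate d f z.
have l1 : 1 <= growth ^+ k by rewrite exprn_ege1 // ltW // growth_gt1.
have far c : root p^`() c -> b ^+ ((d ^ 2).-1 ^ k./2) <= nrm (w - c).
  (* A preimage of a critical point [c] under [f^k] is a critical point of [f^k.+1], hence stays at
     distance [e] from [z]. *)
  move=> /rootP rc; apply: hb => x fx; apply: (hz k.+1).
  by rewrite /root deriv_iter_polyS fx rc mul0r.
have wr : ~~ root p^`() w.
  apply/negP => /far; rewrite subrr nrm0 leNgt exprn_gt0 //.
have hlow c : root p^`() c -> - (- ln b * growth ^+ k) <= ln (nrm (w - c)).
  move=> /far h; have bn : 0 < b ^+ ((d ^ 2).-1 ^ k./2) by rewrite exprn_gt0.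
  have : ln (b ^+ ((d ^ 2).-1 ^ k./2)) <= ln (nrm (w - c)).
    by rewrite ler_ln ?posrE // (lt_le_trans bn).
  apply: le_trans; rewrite lnXn // mulNr opprK -mulr_natr.
  by rewrite ler_wnM2l ?growth_half // -oppr_ge0.
have B1 : 0 <= - ln b * growth ^+ k by rewrite mulr_ge0 // (le_trans ler01).
have u1 := h1 w wr; have u2 := h2 w _ B1 wr hlow.
have := hK z k; rewrite -/w -/G ler_norml => /andP[g1 g2].
set L := logp _ in u1 u2 g1 g2; set t := growth ^+ k in l1 u2 B1 *.
set D := d.-1%:R in u1 u2 d10 *.
have v1 : D * (L - d%:R ^+ k * G) <= D * K by rewrite ler_wpM2l.
have v2 : D * (- K) <= D * (L - d%:R ^+ k * G) by rewrite ler_wpM2l.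
have m1 : D * K + K1 + K2 <= (D * K + K1 + K2) * t.
  by rewrite ler_peMr // !addr_ge0 // mulr_ge0.
have m2 : 0 <= D * (- ln b * t) by rewrite mulr_ge0.
have DK0 : 0 <= D * K by rewrite mulr_ge0.
rewrite -mulrA ler_norml; apply/andP; split; lra.
Qed.

(** The chain rule sums the orbit estimates: [(d - 1) d^k] over [k < n] gives [d^n - 1], and the
    geometric sum of the errors [growth^k] is at most [growth^n / (growth - 1)]. *)
Lemma ln_deriv_iter_poly (e : R) : 0 < e -> exists2 E : R, 0 <= E &
  forall z : C, (forall n w, root (iter_poly n)^`() w -> e <= nrm (z - w)) ->
  forall n, `|ln (nrm (iter_poly n)^`().[z]) -
    (d%:R ^+ n - 1) * escape_rate d f z| <= E * growth ^+ n.
Proof.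
move=> e0; have [E E0 hE] := ln_deriv_along_orbit e0.
have g1 : 0 < growth - 1 by rewrite subr_gt0 growth_gt1.
exists (E / (growth - 1)); first by rewrite divr_ge0 // ltW.
move=> z hz; have nz n : 0 < nrm (iter_poly n)^`().[z].
  rewrite nrm_gt0; apply/negP => /hz; by rewrite subrr nrm0 leNgt e0.
elim=> [|n IH].
  by rewrite /iter_poly /= derivX hornerC nrm1 ln1 subrr mul0r subrr normr0
     expr0 mulr1 divr_ge0 // ltW.
have nz' : 0 < nrm p^`().[iter n f z].
  by have := nz n.+1; rewrite deriv_iter_polyS nrmM pmulr_lgt0.
rewrite deriv_iter_polyS nrmM lnM ?posrE //.
have h := hE z hz n; set G := escape_rate d f z in IH h *.
rewrite (_ : _ - _ = (ln (nrm p^`().[iter n f z]) - d.-1%:R * d%:R ^+ n * G) +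
   (ln (nrm (iter_poly n)^`().[z]) - (d%:R ^+ n - 1) * G)); last first.
  have -> : d.-1%:R = d%:R - 1 :> R.
    by rewrite -[in d%:R](@prednK d) ?(ltnW degree_ge2) // -natr1 addrK.
  by rewrite exprS; ring.
apply: le_trans (ler_normD _ _) _; apply: le_trans (lerD h IH) _.
have -> : E * growth ^+ n = E / (growth - 1) * growth ^+ n * (growth - 1).
  by rewrite [RHS]mulrAC divfK ?gt_eqF.
by rewrite exprSr mulrA mulrBr mulr1 subrK.
Qed.

End Iteration.

(** * Second-order expansion of the logarithm of the modulus of a polynomial *)

Section LogTaylor.
Variable R : realType.
Local Notation C := R[i].

(** Here [ln |1 + t|] is half of [ln (1 + s)] with [s = 2 Re t + |t|^2], squeezed between
    [s / (1 + s)] and [s]. Since [|s| <= 5/2 |t|] and [1 + s >= 1/4], these differ by at most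
    [25 |t|^2]. *)
Lemma ln_nrm_1D (t : C) : nrm t <= 2^-1 ->
  `|ln (nrm (1 + t)) - complex.Re t| <= 13 * nrm t ^+ 2.
Proof.
move=> t2; have tn0 := nrm_ge0 t; have sqt := nrm_sqr t.
have Et : nrm (1 + t) ^+ 2 = 1 + (2 * complex.Re t + nrm t ^+ 2).
  by rewrite !nrm_sqr; case: (t) => a b /=; ring.
have := ler_Re_nrm t; rewrite ler_norml => /andP[a1 a2].
set a := complex.Re t in a1 a2 Et *; set T := nrm t in tn0 t2 Et sqt a1 a2 *.
set s := 2 * a + T ^+ 2 in Et.
have low : 2^-1 <= nrm (1 + t).
  have := nrmB (1 + t) t; rewrite addrK nrm1 -/T; lra.
have n0 : 0 < nrm (1 + t) by apply: lt_le_trans low; rewrite invr_gt0.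
have s4 : 4^-1 <= 1 + s.
  by rewrite -Et; nra.
have -> : ln (nrm (1 + t)) = ln (1 + s) / 2.
  by rewrite -Et lnXn // mulr2n; lra.
have up : ln (1 + s) <= s by apply: le_ln1Dx; lra.
have dn : s / (1 + s) <= ln (1 + s).
  have s1 : 0 < 1 + s by lra.
  rewrite -[leRHS]opprK -lnV ?posrE // lerNr.
  have sE : (1 + s)^-1 = 1 + - (s / (1 + s)) by field; rewrite gt_eqF.
  rewrite [X in ln X]sE.
  apply: le_ln1Dx; rewrite ltrN2 ltr_pdivrMr //; lra.
have dn' : s - 25 * T ^+ 2 <= s / (1 + s).
  rewrite ler_pdivlMr; last by lra.
  have sT : s ^+ 2 <= 25 / 4 * T ^+ 2.
    have : - (5 / 2 * T) <= s <= 5 / 2 * T by apply/andP; rewrite /s; split; nra.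
    by case/andP => ? ?; nra.
  have := sqr_ge0 T; nra.
rewrite /s in up dn dn'.
rewrite ler_norml; apply/andP; split; lra.
Qed.

Lemma ln_nrm_addr (u h : C) (e : R) : 0 < e -> e <= nrm u -> 2 * nrm h <= e ->
  `|ln (nrm (u + h)) - ln (nrm u) - complex.Re (h / u)| <= 13 * (nrm h / e) ^+ 2.
Proof.
move=> e0 eu he; have un0 : 0 < nrm u by apply: lt_le_trans eu.
have u0 : u != 0 by rewrite -nrm_gt0.
have tle : nrm (h / u) <= nrm h / e.
  by rewrite nrmM nrmV ler_wpM2l ?nrm_ge0 // lef_pV2 ?posrE.
have t2 : nrm (h / u) <= 2^-1.
  by apply: le_trans tle _; rewrite ler_pdivrMr //; lra.
have Eu : u + h = u * (1 + h / u) by field.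
have n1 : 0 < nrm (1 + h / u).
  have := nrmB (1 + h / u) (h / u); rewrite addrK nrm1; lra.
rewrite Eu nrmM lnM ?posrE // [ln (nrm u) + _]addrC addrK.
apply: le_trans (ln_nrm_1D t2) _; rewrite ler_pM2l //.
by apply: lerXn2r => //; rewrite nnegrE ?nrm_ge0 ?divr_ge0 ?nrm_ge0 // ltW.
Qed.

(** All three quantities are sums over the roots [w]: of [(z - w)^-1], of [(z - w)^-2], and of the
    Taylor remainders of [ln |z - w|]. Each term is bounded through [e <= |z - w|]. *)
Lemma log_derivatives_bounds (q : {poly C}) z (e : R) : 0 < e -> q != 0 ->
  (forall w, root q w -> e <= nrm (z - w)) ->
  [/\ nrm (q^`().[z] / q.[z]) <= (size q).-1%:R / e,
      nrm ((q^`().[z] / q.[z]) ^+ 2 - q^`()^`().[z] / q.[z])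
        <= (size q).-1%:R / e ^+ 2
    & forall h, 2 * nrm h <= e ->
      `|ln (nrm q.[z + h]) - ln (nrm q.[z]) - complex.Re (h * (q^`().[z] / q.[z]))|
        <= (size q).-1%:R * (13 * (nrm h / e) ^+ 2)].
Proof.
move=> e0 q0 far; have [s [<- Es rs Eln]] := ln_nrm_horner q0.
have zs : z \notin s by apply/negP; rewrite rs => /far; rewrite subrr nrm0 leNgt e0.
have qz : q.[z] != 0 by rewrite -[_ == _]/(root q z) -rs.
have E1 : q^`().[z] / q.[z] = \sum_(w <- s) (z - w)^-1.
  move: qz; rewrite Es derivZ !hornerZ deriv_prod_XsubC // mulrA => qz.
  by rewrite mulrAC divff ?mul1r.
have E2 : q^`()^`().[z] / q.[z] =
    (\sum_(w <- s) (z - w)^-1) ^+ 2 - \sum_(w <- s) (z - w)^-2.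
  move: qz; rewrite Es !derivZ !hornerZ deriv2_prod_XsubC // mulrA => qz.
  by rewrite mulrAC divff ?mul1r.
have near w : w \in s -> e <= nrm (z - w) by rewrite rs; exact: far.
have inv w : w \in s -> (nrm (z - w))^-1 <= e^-1.
  by move=> /near ws; rewrite lef_pV2 ?posrE // (lt_le_trans e0).
split.
- rewrite E1 natr_mul_sum_const; apply: le_trans (nrm_sum _ _) _.
  rewrite big_seq [leRHS]big_seq ler_sum // => w ws.
  by rewrite nrmV inv.
- rewrite E1 E2 opprB addrC subrK natr_mul_sum_const.
  apply: le_trans (nrm_sum _ _) _.
  rewrite big_seq [leRHS]big_seq ler_sum // => w ws.
  rewrite nrmV nrmX -!exprVn; apply: lerXn2r; rewrite ?nnegrE ?invr_ge0 ?nrm_ge0 //.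
    exact: ltW.
  exact: inv.
move=> h he; have zhs : ~~ root q (z + h).
  apply/negP => /far; rewrite opprD addrA subrr add0r nrmN => h1.
  by have := nrm_ge0 h; lra.
rewrite (Eln (z + h)) // (Eln z); last by rewrite -rs.
rewrite opprD addrACA subrr add0r E1 mulr_sumr Re_sum -!sumrB natr_mul_sum_const.
apply: le_trans (ler_norm_sum _ _ _) _.
rewrite big_seq [leRHS]big_seq ler_sum // => w ws.
by rewrite (addrAC z h) ln_nrm_addr ?near.
Qed.

End LogTaylor.

(** * Formal and analytic derivatives of polynomials agree *)

Section PolynomialDerivative.
Variable K : numFieldType.

Lemma is_derive_horner (q : {poly K}) (x : K) :
  is_derive (x : K^o) 1 (horner q : K^o -> K^o) q^`().[x].
Proof.
elim/poly_ind: q => [|q r ih].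
  rewrite (_ : horner 0 = cst 0); last by apply/funext => y; rewrite horner0.
  by rewrite deriv0 horner0; exact: is_derive_cst.
have -> : horner (q * 'X + r%:P) = (horner q : K^o -> K^o) * id + cst r.
  by apply/funext => y; rewrite hornerMXaddC.
have h := is_deriveD (is_deriveM ih (is_derive_id (x : K^o) 1))
  (is_derive_cst (r : K^o) (x : K^o) 1).
apply: is_derive_eq h _.
by rewrite derivMXaddC hornerD hornerM hornerX addr0 /GRing.scale /= mulr1 mulrC.
Qed.

End PolynomialDerivative.

(** * Conjugacy to a power map, and interpolation of derivatives *)

Section Analysis.
Variable R : realType.
Local Notation C := R[i].

Lemma cderive_horner (q : {poly C}) : cderive (horner q) = horner q^`().
Proof.
by apply/funext => x; rewrite /cderive derive1E; case: (is_derive_horner q x).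
Qed.

Lemma entire_horner (q : {poly C}) : entire (horner q).
Proof. by move=> x; case: (is_derive_horner q x). Qed.

(** With [al ^+ d.-1 = a], the affine map [al (z - c)] conjugates [a (z - c)^d + c] to [z^d]. *)
Lemma not_conjugate_power_form (p : {poly C}) d : (2 <= d)%N ->
  ~ conformally_conjugate (horner p) (fun z : C => z ^+ d) ->
  forall a c : C, a != 0 -> p <> a *: ('X - c%:P) ^+ d + c%:P.
Proof.
move=> d2 hconj a c a0 Ep; apply: hconj.
have [al /rootP ral] : exists al, root ('X^(d.-1) - a%:P) al.
  apply/closed_rootP; rewrite size_XnsubC; first by case: d d2 {Ep} => [|[|]].
  by case: d d2 {Ep} => [|[|]].
have {}ral : al ^+ d.-1 = a by move/eqP: ral; rewrite !hornerE subr_eq0 => /eqP.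
have al0 : al != 0.
  by apply: contraNneq a0 => al0; rewrite -ral al0 expr0n; case: d d2 {Ep ral} => [|[|]].
exists (horner (al *: ('X - c%:P))), (horner (al^-1 *: 'X + c%:P)); split.
- by move=> z; rewrite !hornerE /= mulVf // mul1r subrK.
- by move=> z; rewrite !hornerE /= addrK mulVKf.
- exact: entire_horner.
- exact: entire_horner.
move=> z; rewrite Ep !hornerE /= addrK exprMn mulrA -{1}ral -exprS prednK //.
exact: ltnW.
Qed.

(* Landau: a function that is uniformly [eta n]-close to functions with second
   derivative bounded by [2 M] has its derivative [O(M h + eta n / h)]-close to
   theirs. *)
Lemma partial_derivative (G : R -> R) (x : R) (u : nat -> R -> R) (b eta : R^nat)
    (M r : R) : 0 < r -> 0 <= M -> eta @ \oo --> (0 : R) ->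
  (forall n h, `|h| <= r -> `|u n (h + x) - G (h + x)| <= eta n) ->
  (forall n h, `|h| <= r -> `|u n (h + x) - u n x - h * b n| <= M * h ^+ 2) ->
  forall n h, 0 < h -> h <= r ->
    `|b n - derive1 G x| <= 2 * M * h + 2 * eta n / h.
Proof.
move=> r0 M0 eta0 hG hb.
pose D h := h^-1 * (G (h + x) - G x).
have key n h : h != 0 -> `|h| <= r -> `|D h - b n| <= M * `|h| + 2 * eta n / `|h|.
  move=> h0 hr; have hn0 : 0 < `|h| by rewrite normr_gt0.
  have g1 := hG n h hr; have := hG n 0; rewrite normr0 add0r => /(_ (ltW r0)) g2.
  have g3 := hb n h hr.
  have -> : D h - b n = h^-1 * (G (h + x) - G x - h * b n) by rewrite /D; field.
  rewrite normrM normrV ?unitfE // mulrC ler_pdivrMr // mulrDl divfK ?gt_eqF //.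
  rewrite -mulrA -expr2 real_normK ?num_real //.
  move: g1 g2 g3; rewrite !ler_norml; lra.
(* The quotient [D h] does not depend on [n]. Fixing [h] with [M * h <= e / 8] and then [n] with
   [2 * eta n / h <= e / 4] puts every late [b n] within [3 / 8 * e] of it. *)
have /cvg_ex[A bA] : cvg (b @ \oo).
  apply/cauchy_cvgP/cauchyP => e e0.
  pose h := Num.min r (e / (8 * (M + 1))).
  have h0 : 0 < h by rewrite lt_min r0 divr_gt0 // mulr_gt0 //; lra.
  have hr : `|h| <= r by rewrite gtr0_norm // ge_min lexx.
  have hM : M * h <= e / 8.
    have : h <= e / (8 * (M + 1)) by rewrite ge_min lexx orbT.
    rewrite ler_pdivlMr; last by rewrite mulr_gt0 //; lra.
    by move=> ?; nra.
  have [N _ hN] : \forall n \near \oo, `|0 - eta n| <= h * e / 8.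
    by move/cvgrPdist_le: eta0; apply; rewrite divr_gt0 // mulr_gt0.
  have kN n : (N <= n)%N -> `|D h - b n| <= 3 / 8 * e.
    move=> Nn; apply: le_trans (key n h _ hr) _; first by rewrite gt_eqF.
    rewrite gtr0_norm // -lerBrDl ler_pdivrMr //.
    have := hN n Nn; rewrite /= sub0r normrN ler_norml => /andP[_ ?]; nra.
  exists (D h); exists N => // n /= Nn; rewrite /ball /=.
  by apply: le_lt_trans (kN n Nn) _; lra.
(* Letting [n] go to infinity in [key] removes [eta]; then [h] tending to 0 identifies [A] as the
   derivative of [G], whose existence was not assumed. *)
have DA h : h != 0 -> `|h| <= r -> `|D h - A| <= M * `|h|.
  move=> h0 hr; have hn0 : 0 < `|h| by rewrite normr_gt0.
  apply/ler_addgt0Pr => e e0.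
  have [N1 _ hN1] : \forall n \near \oo, `|A - b n| <= e / 2.
    by move/cvgrPdist_le: bA; apply; rewrite divr_gt0.
  have [N2 _ hN2] : \forall n \near \oo, `|0 - eta n| <= `|h| * e / 4.
    by move/cvgrPdist_le: eta0; apply; rewrite divr_gt0 // mulr_gt0.
  pose n := maxn N1 N2.
  have h1 := hN1 n (leq_maxl _ _); have := hN2 n (leq_maxr _ _).
  rewrite /= sub0r normrN ler_norml => /andP[_ h2].
  have h3 : 2 * eta n / `|h| <= e / 2 by rewrite ler_pdivrMr //; nra.
  have := key n h h0 hr; move: h1 h3; rewrite /= !ler_norml; lra.
have dG : derive1 G x = A.
  apply: cvg_lim => //; apply/cvgrPdist_le => e e0.
  pose h0 := Num.min r (e / (M + 1)).
  have h00 : 0 < h0 by rewrite lt_min r0 divr_gt0 //; lra.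
  near=> h.
  have hn0 : h != 0 by near: h; exact: nbhs_dnbhs_neq.
  have hh : `|h| <= h0.
    by near: h; exact: dnbhs0_le.
  have hr : `|h| <= r by apply: le_trans hh _; rewrite ge_min lexx.
  have he : `|h| <= e / (M + 1) by apply: le_trans hh _; rewrite ge_min lexx orbT.
  rewrite distrC; apply: le_trans (DA h hn0 hr) _.
  move: he; rewrite ler_pdivlMr; last by lra.
  have := normr_ge0 h; nra.
move=> n h h0 hr; rewrite dG; have hr' : `|h| <= r by rewrite gtr0_norm.
have hn : h != 0 by rewrite gt_eqF.
have := key n h hn hr'; have := DA h hn hr'; rewrite (gtr0_norm h0) !ler_norml; lra.
Unshelve. all: by end_near.
Qed.

End Analysis.

(** * Balls, closure and uniform convergence through the real modulus *)

Section ComplexTopology.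
Variable R : realType.
Local Notation C := R[i].

Lemma ball_nrm (z w : C) (r : R) : ball (z : C^o) r%:C w <-> nrm (z - w) < r.
Proof.
by rewrite /ball /= -ltcR (_ : (nrm (z - w))%:C = `|z - w|).
Qed.

(** Comparable elements of [R[i]] have equal imaginary parts; hence radii of balls, which are
    complex here, are real. *)
Lemma posc_real (e : C) : 0 < e -> exists2 r : R, 0 < r & e = r%:C.
Proof.
case: e => a b; rewrite ltcE /= => /andP[/eqP b0 a0].
by exists a; rewrite // b0.
Qed.

Lemma notin_closure_dist (A : set C) z : ~ closure (A : set C^o) z ->
  exists2 r : R, 0 < r & forall w, A w -> r <= nrm (z - w).
Proof.
move=> /existsNP[B /not_implyP[/nbhs_ballP[e /= /posc_real[r r0 ->] sub] AB]].
exists r => // w Aw; rewrite leNgt; apply/negP => zw; apply: AB.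
by exists w; split=> //; apply/sub/ball_nrm.
Qed.

Lemma uniform_cvg_nrm (A : set C) (F : nat -> C -> C) (g : C -> C) :
  (forall e : R, 0 < e -> exists N, forall n, (N <= n)%N ->
     forall z, A z -> nrm (F n z - g z) < e) ->
  {uniform A, (F : nat -> C -> C^o) @ \oo --> (g : C -> C^o)}.
Proof.
move=> h P /uniform_nbhs[E [entE sub]].
have [e /= /posc_real[r r0 ->] sE] : exists2 e : C, 0 < e &
    [set xy : C^o * C^o | ball xy.1 e xy.2] `<=` E.
  by move: entE; rewrite -entourage_ballE => -[e /= e0 he]; exists e.
have [N hN] := h r r0; exists N => // n /= Nn.
apply: sub => z Az /=; apply: sE => /=.
by apply/ball_nrm; rewrite nrmBC; exact: hN.
Qed.

End ComplexTopology.

(** * Convergence of the scaled Schwarzian derivatives *)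

Section Convergence.
Variables (R : realType) (p : {poly R[i]}).
Local Notation C := R[i].
Local Notation d := (size p).-1.
Local Notation f := (horner p).
Local Notation G := (escape_rate d f).
Hypothesis sp : (2 < size p)%N.
Hypothesis hp : forall a c : C, a != 0 -> p <> a *: ('X - c%:P) ^+ d + c%:P.

Lemma iter_horner n : iter n f = horner (iter_poly p n).
Proof. by apply/funext => z; rewrite horner_iter_poly. Qed.

Lemma Precrit_root n w : root (iter_poly p n)^`() w -> Precrit f w.
Proof.
case: n => [|n] /rootP rw.
  (* [Precrit] omits [n = 0], but the identity has derivative 1 and no critical point. *)
  by move: rw; rewrite derivX hornerC => /eqP; rewrite oner_eq0.
by exists n.+1 => //=; rewrite iter_horner cderive_horner.
Qed.

(** Twice the Wirtinger derivative of [d^-n ln |(f^n)'|]. *)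
Definition scaled_log_derivative n (z : C) : C :=
  (iter_poly p n)^`()^`().[z] / (iter_poly p n)^`().[z] / d%:R ^+ n.

Let dR0 : 0 < d%:R :> R. Proof. by rewrite ltr0n (ltn_trans _ (degree_ge2 sp)). Qed.

Let dR1 : 1 < d%:R :> R. Proof. by rewrite ltr1n degree_ge2. Qed.

Let nrm_dX n : nrm (d%:R ^+ n : C) = d%:R ^+ n.
Proof. by rewrite nrmX nrm_nat. Qed.

Let dX0 n : 0 < d%:R ^+ n :> R. Proof. by rewrite exprn_gt0. Qed.

Lemma size_deriv_iter_poly n : (size (iter_poly p n)^`()).-1%:R <= d%:R ^+ n :> R.
Proof. by rewrite size_derivC size_iter_poly -natrX ler_nat leq_pred. Qed.

Lemma deriv_iter_poly_neq0 n : (iter_poly p n)^`() != 0.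
Proof.
rewrite -size_poly_eq0 size_derivC size_iter_poly -lt0n expn_gt0.
by rewrite (ltn_trans _ (degree_ge2 sp)).
Qed.

(** The last bracket is minus the derivative of [q' / q]; by [log_derivatives_bounds] it is only
    [O(d^n)], negligible against [d^(2n)]. *)
Lemma Schwarzian_iter n (z : C) : let B := scaled_log_derivative n z in
  let q := (iter_poly p n)^`() in
  Schwarzian (iter n f) z / d%:R ^+ (2 * n) =
  - (B ^+ 2 / 2) - ((q^`().[z] / q.[z]) ^+ 2 - q^`()^`().[z] / q.[z]) / d%:R ^+ (2 * n).
Proof.
rewrite /= /Schwarzian iter_horner !cderive_horner /scaled_log_derivative.
have t0 : (d%:R ^+ n : C) != 0 by rewrite -nrm_gt0 nrm_dX.
have alg (x y t : C) : t != 0 -> (y - 3 / 2 * x ^+ 2) / (t * t) =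
    - ((x / t) ^+ 2 / 2) - (x ^+ 2 - y) / (t * t) by move=> ?; field.
by rewrite mul2n -addnn exprD; exact: alg.
Qed.

Lemma cvg_growth (E G0 : R) :
  (fun n => (E * growth p ^+ n + G0) / d%:R ^+ n) @ \oo --> 0.
Proof.
have -> : (fun n => (E * growth p ^+ n + G0) / d%:R ^+ n) =
    (fun n => E * (growth p / d%:R) ^+ n + G0 * d%:R^-1 ^+ n).
  by apply/funext => n; rewrite mulrDl expr_div_n exprVn mulrA.
have g0 : 0 < growth p by apply: lt_trans (growth_gt1 sp).
have h1 : (fun n => E * (growth p / d%:R) ^+ n) @ \oo --> E * 0.
  apply: cvgMr; apply: cvg_expr; rewrite ger0_norm; last first.
    by rewrite divr_ge0 ?(ltW g0) ?(ltW dR0).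
  by rewrite ltr_pdivrMr // mul1r growth_ltd.
have h2 : (fun n => G0 * d%:R^-1 ^+ n) @ \oo --> G0 * 0.
  apply: cvgMr; apply: cvg_expr.
  by rewrite ger0_norm ?invr_ge0 ?(ltW dR0) // invf_lt1.
by have := cvgD h1 h2; rewrite !mulr0 addr0; apply.
Qed.

Variables (z0 : C) (rho : R).
Hypothesis rho0 : 0 < rho.
Hypothesis far : forall n w, root (iter_poly p n)^`() w -> rho <= nrm (z0 - w).

Let far2 (z : C) n w : nrm (z0 - z) <= rho / 2 -> root (iter_poly p n)^`() w ->
  rho / 2 <= nrm (z - w).
Proof.
move=> zz /far h; have := nrmD (z0 - z) (z - w); rewrite addrA subrK; lra.
Qed.

Let half0 : 0 < rho / 2. Proof. by rewrite divr_gt0. Qed.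

Let U n (z : C) := ln (nrm (iter_poly p n)^`().[z]) / d%:R ^+ n.

Let M := 13 / (rho / 2) ^+ 2.

Let M0 : 0 <= M. Proof. by rewrite divr_ge0 // exprn_ge0 // ltW. Qed.

(** Replacing [d^n - 1] by [d^n] in [ln_deriv_iter_poly] costs one [G z], bounded near [z0] by
    [escape_rate_iter] at [n = 0]; the total error is divided by [d^n], and [growth < d]. *)
Lemma log_deriv_iter_cvg : exists2 eta : R^nat, eta @ \oo --> (0 : R) &
  forall n (z : C), nrm (z0 - z) <= rho / 2 -> `|U n z - G z| <= eta n.
Proof.
have [E E0 hE] := ln_deriv_iter_poly sp hp half0.
have [K K0 hK] := escape_rate_iter sp.
pose G0 := K + ln (1 + (nrm z0 + rho)).
exists (fun n => (E * growth p ^+ n + G0) / d%:R ^+ n); first exact: cvg_growth.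
move=> n z zz; have h := hE z (fun n w => far2 zz) n.
have z00 := nrm_ge0 z0.
have Gz : `|G z| <= G0.
  have L0 := logp_ge0 (nrm z).
  have : logp (nrm z) <= ln (1 + (nrm z0 + rho)).
    apply: logp_le; last by rewrite lerDl addr_ge0 // ltW.
    have tri : nrm z <= nrm z0 + nrm (z0 - z) by rewrite -{1}(subKr z0 z) nrmB.
    by apply: le_trans tri _; move: zz rho0; set t := nrm (z0 - z); lra.
  have := hK z 0%N; rewrite expr0 mul1r /= /G0 !ler_norml; lra.
rewrite ler_pdivlMr // -[X in _ * X]ger0_norm ?(ltW (dX0 n)) // -normrM.
rewrite mulrBl /U divfK ?gt_eqF //.
have -> : ln (nrm (iter_poly p n)^`().[z]) - G z * d%:R ^+ n =
  ln (nrm (iter_poly p n)^`().[z]) - (d%:R ^+ n - 1) * G z - G z by ring.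
by apply: le_trans (ler_normB _ _) _; rewrite lerD.
Qed.

(** The number of roots of the derivative is at most [d^n], which the scaling cancels; so [M] is
    independent of [n]. *)
Lemma log_deriv_iter_taylor n (z h : C) : nrm (z0 - z) <= rho / 2 ->
  2 * nrm h <= rho / 2 ->
  `|U n (z + h) - U n z - complex.Re (h * scaled_log_derivative n z)|
    <= M * nrm h ^+ 2.
Proof.
move=> zz hh.
have [_ _ /(_ h hh) key] :=
  log_derivatives_bounds half0 (deriv_iter_poly_neq0 n) (fun w => far2 zz).
have -> : complex.Re (h * scaled_log_derivative n z) =
  complex.Re (h * ((iter_poly p n)^`()^`().[z] / (iter_poly p n)^`().[z])) / d%:R ^+ n.
  rewrite /scaled_log_derivative mulrA -(natrX _ d n) -(natrX _ d n).
  set x := h * _; rewrite (_ : (d ^ n)%:R^-1 = ((d ^ n)%:R^-1)%:C).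
    by case: x => a b /=; rewrite mulr0 subr0.
  by rewrite fmorphV rmorph_nat.
rewrite /U -!mulrBl normrM [X in _ * X]ger0_norm ?invr_ge0 ?(ltW (dX0 n)) //.
rewrite ler_pdivrMr //; apply: le_trans key _.
apply: le_trans (ler_wpM2r _ (size_deriv_iter_poly n)) _.
  by rewrite mulr_ge0 // sqr_ge0.
by rewrite [leRHS]mulrC /M expr_div_n -mulrA (mulrC _^-1).
Qed.

(** Real and imaginary increments in the Taylor bound show that [Re B] and [- Im B] approximate the
    two partial derivatives of [G]. The radius [rho / 4] keeps the shifted points within [rho / 2]
    of [z0]. *)
Lemma scaled_log_derivative_cvg : exists2 eta : R^nat, eta @ \oo --> (0 : R) &
  forall n (z : C) h, nrm (z0 - z) <= rho / 4 -> 0 < h -> h <= rho / 4 ->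
    nrm (scaled_log_derivative n z - 2 * wirtinger_dz G z)
      <= 4 * M * h + 4 * eta n / h.
Proof.
have [eta eta0 hU] := log_deriv_iter_cvg; exists eta => // n z h zz h0 hr.
have r0 : 0 < rho / 4 by rewrite divr_gt0.
set B := scaled_log_derivative.
have z2 : nrm (z0 - z) <= rho / 2 by lra.
have hU' k v : nrm v <= rho / 4 -> `|U k (z + v) - G (z + v)| <= eta k.
  by move=> hv; apply: hU; rewrite opprD addrA (le_trans (nrmB _ _)) //; lra.
have hT k v : nrm v <= rho / 4 ->
    `|U k (z + v) - U k z - complex.Re (v * B k z)| <= M * nrm v ^+ 2.
  by move=> hv; apply: log_deriv_iter_taylor => //; lra.
have shx v : (v + complex.Re z) +i* complex.Im z = z + v%:C.
  by case: (z) => a b; simpc; rewrite addrC.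
have shy v : complex.Re z +i* (v + complex.Im z) = z + v *i.
  by case: (z) => a b; simpc; rewrite addrC.
have zE : complex.Re z +i* complex.Im z = z by case: (z).
have dx := @partial_derivative R (fun x => G (x +i* complex.Im z)) (complex.Re z)
  (fun k x => U k (x +i* complex.Im z)) (fun k => complex.Re (B k z)) eta M _ r0 M0 eta0.
have {}dx := dx _ _ n h h0 hr.
have dy := @partial_derivative R (fun y => G (complex.Re z +i* y)) (complex.Im z)
  (fun k y => U k (complex.Re z +i* y)) (fun k => - complex.Im (B k z)) eta M _ r0 M0 eta0.
have {}dy := dy _ _ n h h0 hr.
apply: le_trans (nrm_le_ReIm _) _.
rewrite /wirtinger_dz mulrA divff ?pnatr_eq0 // mul1r.
set X := derive1 _ _ in dx *; set Y := derive1 _ _ in dy *.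
have -> : complex.Re (B n z - (X -i* Y)) = complex.Re (B n z) - X.
  by case: (B n z).
have -> : complex.Im (B n z - (X -i* Y)) = - (- complex.Im (B n z) - Y).
  by case: (B n z) => a b /=; ring.
rewrite normrN; apply: le_trans (lerD (dx _ _) (dy _ _)) _.
- by move=> k v hv; rewrite shx hU' ?nrm_real.
- move=> k v hv; rewrite shx zE; have := hT k v%:C; rewrite nrm_real => /(_ hv).
  rewrite real_normK ?num_real //.
  by rewrite (_ : complex.Re _ = v * complex.Re (B k z)) //; case: (B k z) => a b /=; ring.
- by move=> k v hv; rewrite shy hU' ?nrm_imag.
- move=> k v hv; rewrite shy zE; have := hT k (v *i); rewrite nrm_imag => /(_ hv).
  rewrite real_normK ?num_real //.
  by rewrite (_ : complex.Re _ = v * - complex.Im (B k z)) //; case: (B k z) => a b /=; ring.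
lra.
Qed.

(** With [A = 2 dG/dz] the difference is [- (B - A) (B + A) / 2] minus the negligible term of
    [Schwarzian_iter]; these contribute at most [e / 2] and [e / 4]. *)
Lemma Schwarzian_cvg (e : R) : 0 < e -> exists N, forall n, (N <= n)%N ->
  forall z : C, nrm (z0 - z) <= rho / 4 ->
  nrm (Schwarzian (iter n f) z / d%:R ^+ (2 * n)
       - (- 2 * wirtinger_dz G z ^+ 2)) < e.
Proof.
move=> e0; have [eta eta0 hB] := scaled_log_derivative_cvg.
have r0 : 0 < rho / 4 by rewrite divr_gt0.
(* [k] bounds [|B + A| = |2 B - (B - A)|], from [|B| <= 2 / rho] and [|B - A| <= e1 <= 1]. *)
pose k := 1 + 2 * (2 / rho).
have k0 : 0 < k by rewrite addr_gt0 // mulr_gt0 // divr_gt0.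
pose e1 := Num.min 1 (e / k).
have e10 : 0 < e1 by rewrite lt_min ltr01 divr_gt0.
(* [h] is fixed before [n]: it makes [4 * M * h] at most [e1 / 2], and a large [n] then does the
   same for [4 * eta n / h]. *)
pose h := Num.min (rho / 4) (e1 / (8 * (M + 1))).
have h0 : 0 < h by rewrite lt_min r0 divr_gt0 // mulr_gt0 // ltr_wpDl.
have hr : h <= rho / 4 by rewrite ge_min lexx.
have Mh : 4 * M * h <= e1 / 2.
  have : h <= e1 / (8 * (M + 1)) by rewrite ge_min lexx orbT.
  rewrite ler_pdivlMr ?mulr_gt0 ?ltr_wpDl // => ?; lra.
have [N1 _ hN1] : \forall n \near \oo, `|0 - eta n| <= h * e1 / 8.
  by move/cvgrPdist_le: eta0; apply; rewrite divr_gt0 // mulr_gt0.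
have [N2 _ hN2] : \forall n \near \oo,
    `|0 - (0 * growth p ^+ n + (2 / rho) ^+ 2) / d%:R ^+ n| <= e / 4.
  by move/cvgrPdist_le: (cvg_growth 0 ((2 / rho) ^+ 2)); apply; rewrite divr_gt0.
exists (maxn N1 N2) => n; rewrite geq_max => /andP[Nn1 Nn2] z zz.
have z2 : nrm (z0 - z) <= rho / 2 by lra.
have [b1 b2 _] := log_derivatives_bounds half0 (deriv_iter_poly_neq0 n) (fun w => far2 z2).
rewrite Schwarzian_iter.
set B := scaled_log_derivative n z.
set S := _ - _ / _ in b2 *.
have S_le : nrm (S / d%:R ^+ (2 * n)) <= e / 4.
  have := hN2 n Nn2; rewrite /= mul0r !add0r normrN ger0_norm; last first.
    by rewrite divr_ge0 ?sqr_ge0 ?(ltW (dX0 n)).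
  apply: le_trans; rewrite nrmM nrmV nrm_dX ler_pdivrMr ?dX0 //.
  apply: le_trans b2 _; rewrite mul2n -addnn exprD mulrA divfK ?gt_eqF //.
  rewrite mulrC -exprVn invf_div ler_pM2l ?size_deriv_iter_poly //.
  by rewrite exprn_gt0 // divr_gt0.
have B_le : nrm B <= 2 / rho.
  rewrite nrmM nrmV nrm_dX ler_pdivrMr ?dX0 //.
  apply: le_trans b1 _; rewrite invf_div mulrC ler_pM2l ?size_deriv_iter_poly //.
  by rewrite divr_gt0.
set A := 2 * wirtinger_dz G z.
have BA : nrm (B - A) <= e1.
  apply: le_trans (hB n z h zz h0 hr) _.
  have := hN1 n Nn1; rewrite /= sub0r normrN ler_norml => /andP[_ h2].
  have : 4 * eta n / h <= e1 / 2 by rewrite ler_pdivrMr //; lra.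
  lra.
have -> : - (B ^+ 2 / 2) - S / d%:R ^+ (2 * n) - - 2 * wirtinger_dz G z ^+ 2 =
    - ((B - A) * (B + A) / 2) - S / d%:R ^+ (2 * n).
  by rewrite /A; set t := S / _; field.
apply: le_lt_trans (nrmB _ _) _; move: S_le; set t := nrm (S / _) => S_le.
rewrite nrmN !nrmM nrmV nrm_nat.
have BpA : nrm (B + A) <= k.
  have -> : B + A = 2 * B - (B - A) by ring.
  apply: le_trans (nrmB _ _) _; rewrite nrmM nrm_nat.
  have : e1 <= 1 by rewrite ge_min lexx.
  rewrite /k; lra.
have : nrm (B - A) * nrm (B + A) <= e1 * k by rewrite ler_pM ?nrm_ge0.
have : e1 * k <= e by rewrite -ler_pdivlMr // ge_min lexx orbT.
lra.
Qed.

End Convergence.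

Unset Implicit Arguments.

Theorem theorem1p1 (R : realType) (d : nat) (p : {poly R[i]})
    (hd : (2 <= d)%N) (hp : size p = d.+1)
    (hconj : ~ conformally_conjugate (horner p) (fun z : R[i] => z ^+ d)) :
  locally_uniform_cvg (~` closure (Precrit (horner p) : set R[i]^o))
    (fun n z => Schwarzian (iter n (horner p)) z / d%:R ^+ (2 * n))
    (fun z => - 2 * wirtinger_dz (escape_rate d (horner p)) z ^+ 2).
Proof.
have form := not_conjugate_power_form hd hconj.
have Ed : d = (size p).-1 by rewrite hp.
have sp : (2 < size p)%N by rewrite hp.
rewrite Ed in form *.
move=> z0 /notin_closure_dist[rho rho0 hrho].
have far n w : root (iter_poly p n)^`() w -> rho <= nrm (z0 - w).
  by move=> /Precrit_root; exact: hrho.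
exists (ball (z0 : R[i]^o) (rho / 4)%:C).
  by apply: nbhsx_ballx; rewrite ltcR divr_gt0.
apply: uniform_cvg_nrm => e e0.
have [N hN] := Schwarzian_cvg sp form rho0 far e0.
exists N => n Nn z [/ball_nrm zz _]; apply: hN => //; exact: ltW.
Qed.
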